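(* Let $\sigma$ be a trace and let $e_1 \leq^{\sigma}_{\mathsf{tr}} e_2$ be conflicting events in $\sigma$. Then $(e_1,e_2)$ is a $\leq^{\sigma}_{\mathsf{HB}}$-schedulable race if and only if either $\mathsf{pred}_\sigma(e_2)$ is undefined, or $e_1 \not\leq^{\sigma}_{\mathsf{SHB}} \mathsf{pred}_\sigma(e_2)$.
   Context: **Traces.** A trace $\sigma$ is a finite sequence of events of the form $e=\langle t, op\rangle$, where $t$ is a thread (the thread performing $e$) and $op$ is one of $\mathtt{r}(x)$, $\mathtt{w}(x)$ (read/write of memory location $x$), $\mathtt{acq}(\ell)$, $\mathtt{rel}(\ell)$ (acquire/release of lock $\ell$), $\mathtt{fork}(u)$, $\mathtt{join}(u)$ (fork/join of thread $u$). Each event has a unique identifier, so two occurrences of the same operation by the same thread are different events. Locks are not reentrant. $\mathsf{Threads}(\sigma)$ and $\mathsf{Events}(\sigma)$ are the sets of threads and events of $\sigma$. Traces are well formed: for every lock $\ell$, the subsequence $\sigma|_\ell$ of acquire and release events of $\ell$ is a prefix of a string in the regular language $\big(\bigcup_{t}\langle t,\mathtt{acq}(\ell)\rangle\cdot\langle t,\mathtt{rel}(\ell)\rangle\big)^*$. **Events of a thread.** $e=\langle t_1,op\rangle$ is an event of thread $t$ if $t=t_1$ or $op\in\{\mathtt{fork}(t),\mathtt{join}(t)\}$ (so fork/join events are events of two threads). $\sigma|_t$ is the maximal subsequence of $\sigma$ consisting of events of thread $t$. $\mathsf{pred}_\sigma(e)$ is the last event $e'$ strictly before $e$ in $\sigma$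 such that $e$ and $e'$ are events of the same thread; it may be undefined. **Last write.** For a read event $e$ of location $x$, $\mathsf{lastWr}_\sigma(e)$ is the last $\mathtt{w}(x)$-event before $e$ in $\sigma$ (undefined if there is none). **Orders on $\mathsf{Events}(\sigma)$.** $e\leq^\sigma_{\mathsf{tr}}e'$ iff $e=e'$ or $e$ appears before $e'$ in $\sigma$. $\leq^\sigma_{\mathsf{TO}}$ (thread order) is the smallest partial order with $e\leq^\sigma_{\mathsf{TO}}e'$ whenever $e\leq^\sigma_{\mathsf{tr}}e'$ and $e,e'$ are events of the same thread. $\leq^\sigma_{\mathsf{HB}}$ (happens-before) is the smallest partial order containing $\leq^\sigma_{\mathsf{TO}}$ such that $e\leq^\sigma_{\mathsf{HB}}e'$ whenever $e=\langle t,\mathtt{rel}(\ell)\rangle$, $e'=\langle t',\mathtt{acq}(\ell)\rangle$ and $e\leq^\sigma_{\mathsf{tr}}e'$. $\leq^\sigma_{\mathsf{SHB}}$ (schedulable happens-before) is the smallest partial order containing $\leq^\sigma_{\mathsf{HB}}$ such that $\mathsf{lastWr}_\sigma(e')\leq^\sigma_{\mathsf{SHB}}e'$ for every read event $e'$ for which $\mathsf{lastWr}_\sigma(e')$ is defined. **Reorderings.** A trace $\sigma'$ is a correct reordering of $\sigma$ if (a) for every $t\in\mathsf{Threads}(\sigma')$, $\sigma'|_t$ is a prefix of $\sigma|_t$; and (b) for every read event $e=\langle t,\mathtt{r}(x)\rangle$ of $\sigma'$ that is not the last event of $\sigma'|_t$, $\mathsf{lastWr}_{\sigma'}(e)$ exists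 iff $\mathsf{lastWr}_\sigma(e)$ exists, and if they exist they are equal. A trace $\sigma'$ respects $\leq^\sigma_{\mathsf{HB}}$ if for all $e,e'\in\mathsf{Events}(\sigma)$ with $e\leq^\sigma_{\mathsf{HB}}e'$ and $e'\in\mathsf{Events}(\sigma')$, we have $e\in\mathsf{Events}(\sigma')$ and $e\leq^{\sigma'}_{\mathsf{tr}}e'$. **Races.** Two read/write events are conflicting if they access the same memory location, are performed by different threads, and at least one is a write. For conflicting $e\leq^\sigma_{\mathsf{tr}}e'$, $(e,e')$ is a $\leq^\sigma_{\mathsf{HB}}$-schedulable race if there is a correct reordering $\sigma'$ of $\sigma$ that respects $\leq^\sigma_{\mathsf{HB}}$ and has the form $\sigma'=\sigma''ee'$ or $\sigma'=\sigma''e'e$ for some trace $\sigma''$. *)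

(* Defs.v *)
From HB Require Import structures.
From mathcomp Require Import all_boot.

Set Implicit Arguments.
Unset Strict Implicit.
Unset Printing Implicit Defensive.

Section Events.
Variables (Id Thread Loc Lock : eqType).

Inductive operation :=
| Read of Loc | Write of Loc
| Acq of Lock | Rel of Lock
| Fork of Thread | Join of Thread.

Definition operation_code (o : operation) :
    (Loc + Loc) + (Lock + Lock) + (Thread + Thread) :=
  match o with
  | Read x => inl (inl (inl x)) | Write x => inl (inl (inr x))
  | Acq l => inl (inr (inl l)) | Rel l => inl (inr (inr l))
  | Fork u => inr (inl u) | Join u => inr (inr u)
  end.

Definition operation_decode
    (c : (Loc + Loc) + (Lock + Lock) + (Thread + Thread)) : operation :=
  match c with
  | inl (inl (inl x)) => Read x | inl (inl (inr x)) => Write x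
  | inl (inr (inl l)) => Acq l | inl (inr (inr l)) => Rel l
  | inr (inl u) => Fork u | inr (inr u) => Join u
  end.

Lemma operation_codeK : cancel operation_code operation_decode.
Proof. by case. Qed.

HB.instance Definition _ := Equality.copy operation (can_type operation_codeK).

Record event := Event {
  event_id : Id;
  event_thread : Thread;
  event_op : operation }.

Definition event_code (e : event) : Id * (Thread * operation) :=
  (event_id e, (event_thread e, event_op e)).

Definition event_decode (c : Id * (Thread * operation)) : event :=
  Event c.1 c.2.1 c.2.2.

Lemma event_codeK : cancel event_code event_decode.
Proof. by case. Qed.

HB.instance Definition _ := Equality.copy event (can_type event_codeK).

Implicit Types (s : seq event) (e : event) (t : Thread) (x : Loc) (l : Lock).

Definition is_read x e := event_op e == Read x.
Definition is_write x e := event_op e == Write x.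
Definition is_acq l e := event_op e == Acq l.
Definition is_rel l e := event_op e == Rel l.

Definition on_lock s l : seq event :=
  [seq e <- s | is_acq l e || is_rel l e].

(* The identifiers are forgotten: the language of critical sections of l is a
   language over pairs (thread, operation). Its words are indexed by the
   sequence ts of threads that successively hold l. *)
Definition lock_well_formed s l : Prop :=
  exists ts : seq Thread,
    prefix [seq (event_thread e, event_op e) | e <- on_lock s l]
           (flatten [seq [:: (t, Acq l); (t, Rel l)] | t <- ts]).

Record trace := Trace {
  trace_events :> seq event;
  trace_ids_uniq : uniq [seq event_id e | e <- trace_events];
  trace_locks : forall l, lock_well_formed trace_events l }.

(* A fork or join event is an event of two threads. *)
Definition threads_of_event e : seq Thread :=
  event_thread e ::
  match event_op e with Fork u | Join u => [:: u] | _ => [::] end.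

Definition event_of t e : bool := t \in threads_of_event e.

Definition same_thread e e' : bool := has (event_of^~ e') (threads_of_event e).

Definition threads s : seq Thread := flatten [seq threads_of_event e | e <- s].

Definition on_thread s t : seq event := [seq e <- s | event_of t e].

Definition olast (T : Type) (r : seq T) : option T := ohead (rev r).

Definition before s e : seq event := take (index e s) s.

Definition pred_event s e : option event :=
  olast [seq e' <- before s e | same_thread e e'].

Definition last_write s e : option event :=
  if event_op e is Read x then olast [seq e' <- before s e | is_write x e']
  else None.

Definition le_tr s e e' : bool :=
  [&& e \in s, e' \in s & index e s <= index e' s].

Record partial_order_on s (R : event -> event -> Prop) : Prop := PartialOrderOn {
  po_dom : forall e e', R e e' -> e \in s /\ e' \in s;
  po_refl : forall e, e \in s -> R e e;
  po_anti : forall e e', R e e' -> R e' e -> e = e';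
  po_trans : forall e e' e'', R e e' -> R e' e'' -> R e e'' }.

(* The intersection of all partial orders on the events of s that contain B.
   It is the smallest one as soon as there is one (least_poP); for the three
   orders below le_tr is one (le_TO_po, le_HB_po, le_SHB_po). *)
Definition least_po s (B : event -> event -> Prop) e e' : Prop :=
  forall R : event -> event -> Prop,
    partial_order_on s R -> (forall a b, B a b -> R a b) -> R e e'.

Definition le_TO s : event -> event -> Prop :=
  least_po s (fun e e' => le_tr s e e' && same_thread e e').

Definition le_HB s : event -> event -> Prop :=
  least_po s (fun e e' =>
    le_TO s e e' \/ exists l, [&& is_rel l e, is_acq l e' & le_tr s e e']).

Definition le_SHB s : event -> event -> Prop :=
  least_po s (fun e e' =>
    le_HB s e e' \/ (e' \in s /\ last_write s e' = Some e)).

(* The equality of options says that both last writes are undefined, or both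
   are defined and equal. *)
Definition correct_reordering (s s' : trace) : Prop :=
  (forall t, t \in threads s' -> prefix (on_thread s' t) (on_thread s t)) /\
  (forall e x, e \in trace_events s' -> is_read x e ->
     olast (on_thread s' (event_thread e)) <> Some e ->
     last_write s' e = last_write s e).

Definition respects_HB (s s' : trace) : Prop :=
  forall e e', e \in trace_events s -> e' \in trace_events s ->
    le_HB s e e' -> e' \in trace_events s' ->
    e \in trace_events s' /\ le_tr s' e e'.

Definition conflicting e e' : Prop :=
  event_thread e != event_thread e' /\
  exists x, [&& is_read x e || is_write x e, is_read x e' || is_write x e'
              & is_write x e || is_write x e'].

Definition HB_schedulable_race (s : trace) e e' : Prop :=
  [/\ conflicting e e', le_tr s e e' &
   exists s' s'' : trace,
     [/\ correct_reordering s s', respects_HB s s' &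
         trace_events s' = trace_events s'' ++ [:: e; e'] \/
         trace_events s' = trace_events s'' ++ [:: e'; e] ] ].

Lemma least_poP s (B P : event -> event -> Prop) :
  partial_order_on s P -> (forall a b, B a b -> P a b) ->
  partial_order_on s (least_po s B) /\ (forall a b, B a b -> least_po s B a b).
Proof.
move=> poP BP; split; last by move=> a b Bab R _; apply.
split.
- by move=> e e' /(_ P poP BP) /(po_dom poP).
- by move=> e es R poR _; apply: po_refl poR _ es.
- by move=> e e' /(_ P poP BP) h /(_ P poP BP); apply: (po_anti poP).
- move=> e e' e'' h1 h2 R poR BR.
  exact: po_trans poR _ _ _ (h1 R poR BR) (h2 R poR BR).
Qed.

Lemma le_tr_po s : partial_order_on s (le_tr s).
Proof.
split.
- by move=> e e' /and3P[].
- by move=> e es; rewrite /le_tr es /=.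
- move=> e e' /and3P[es e's le1] /and3P[_ _ le2].
  by apply: (index_inj e es e's); apply/eqP; rewrite eqn_leq le1.
- move=> e e' e'' /and3P[es _ le1] /and3P[_ e''s le2].
  by rewrite /le_tr es e''s (leq_trans le1 le2).
Qed.

Lemma le_TO_tr s e e' : le_TO s e e' -> le_tr s e e'.
Proof. by move/(_ _ (le_tr_po s)); apply=> a b /andP[]. Qed.

Lemma le_HB_tr s e e' : le_HB s e e' -> le_tr s e e'.
Proof.
move/(_ _ (le_tr_po s)); apply=> a b.
by move=> [/le_TO_tr | [l /and3P[]]].
Qed.

Lemma olast_mem (T : eqType) (r : seq T) a : olast r = Some a -> a \in r.
Proof.
rewrite /olast -(mem_rev r); case: (rev r) => //= b q [->].
exact: mem_head.
Qed.

Lemma last_write_tr s e e' :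
  e' \in s -> last_write s e' = Some e -> le_tr s e e'.
Proof.
rewrite /last_write => e's; case: (event_op e') => // x /olast_mem.
rewrite mem_filter => /andP[_ h]; rewrite /le_tr e's (mem_take h) /=.
by apply: ltnW; apply: index_ltn.
Qed.

Lemma le_SHB_tr s e e' : le_SHB s e e' -> le_tr s e e'.
Proof.
move/(_ _ (le_tr_po s)); apply=> a b.
by move=> [/le_HB_tr | [bs]]; last exact: last_write_tr.
Qed.

Lemma le_TO_po s : partial_order_on s (le_TO s).
Proof.
refine (proj1 (least_poP (le_tr_po s) _)) => a b Bab.
by case/andP: Bab.
Qed.

Lemma le_HB_po s : partial_order_on s (le_HB s).
Proof.
refine (proj1 (least_poP (le_tr_po s) _)) => a b Bab.
by case: Bab => [/le_TO_tr | [l /and3P[]]].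
Qed.

Lemma le_SHB_po s : partial_order_on s (le_SHB s).
Proof.
refine (proj1 (least_poP (le_tr_po s) _)) => a b Bab.
by case: Bab => [/le_HB_tr | [bs]]; last exact: last_write_tr.
Qed.

End Events.

(* Main.v *)
(** For necessity, let s' witness the race. Going backwards along the edges
    that generate SHB, the property "the event lies in s' and, if it is a read,
    it is not the last event of its thread in s'" is preserved, and the order
    of s' is respected: a read is left only by thread-order edges, so a read
    strictly below an event of s' is followed in s' by an event of its thread.
    The predecessor p of e2 has this property, hence everything SHB-below p
    occurs in s' up to p, whereas e1 occurs after p.

    For sufficiency, keep the events of s that are SHB-below the predecessor of
    e1 or of e2, in the order of s, and append e1 and e2. The result respects
    HB, and HB is total on the events of a thread and on the events of a lock,
    so the projections of s' to threads and locks are prefixes of those of s.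
    Closure under SHB retains the last writes. *)
Require Import Defs.
From mathcomp Require Import all_boot.
From mathcomp Require Import boolp.

Set Implicit Arguments.
Unset Strict Implicit.
Unset Printing Implicit Defensive.

(** * Prefixes, positions and last elements of sequences *)

Section Sequences.
Variable T : eqType.
Implicit Types (r u v : seq T) (p : pred T) (a b x : T).

Lemma leq_index_filter p r a b : p a -> p b ->
  (index a (filter p r) <= index b (filter p r)) = (index a r <= index b r).
Proof.
move=> pa pb; elim: r => //= x r IH.
have [->|xa] := eqVneq x a; first by rewrite pa /= eqxx.
have [xb|xb] := eqVneq x b; first by rewrite xb pb /= eqxx -xb (negbTE xa).
by case: (p x); rewrite /= ?(negbTE xa) ?(negbTE xb) ?ltnS IH.
Qed.

Lemma take_index_filter p r a : p a ->
  take (index a (filter p r)) (filter p r) = filter p (take (index a r) r).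
Proof.
move=> pa; elim: r => //= x r IH.
have [->|xa] := eqVneq x a; first by rewrite pa /= eqxx.
by rewrite /=; case: (p x); rewrite /= ?(negbTE xa) /= IH.
Qed.

(** Induction on [v] from the right: the element of [u] just after the part already matched comes no
    later in [u] than the next element [x] of [v], so closure forces it to be [x]. *)
Lemma prefix_closed u v : uniq u -> uniq v -> {subset v <= u} ->
  (forall a b, a \in u -> b \in v -> index a u <= index b u ->
     a \in v /\ index a v <= index b v) ->
  prefix v u.
Proof.
move=> uu; elim/last_ind: v => [|v x IH]; first by rewrite prefix0s.
rewrite rcons_uniq => /andP[xv uv] sub cl.
have /prefixP[w def_u] : prefix v u.
  apply: IH => // [y yv|a b au bv ab].
    by apply: sub; rewrite mem_rcons inE yv orbT.
  (* Closure passes from [rcons v x] to [v]: whatever precedes an element of [v] has position below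
     [size v]. *)
  have [|av] := cl a b au _ ab; first by rewrite mem_rcons inE bv orbT.
  rewrite -!cats1 !index_cat bv; case: ifP => // _ ab'.
  have : index b v < size v by rewrite index_mem.
  by rewrite ltnNge (leq_trans (leq_addr _ _) ab').
have xu : x \in u by apply: sub; rewrite mem_rcons mem_head.
case: w def_u => [|y w] def_u; first by rewrite def_u cats0 (negbTE xv) in xu.
suff -> : x = y.
  by rewrite def_u -cat_rcons; apply: prefix_prefix.
have yv : y \notin v.
  by move: uu; rewrite def_u cat_uniq /= negb_or => /and3P[_ /andP[]].
have [|||] := cl y x.
- by rewrite def_u mem_cat mem_head orbT.
- by rewrite mem_rcons mem_head.
- by rewrite def_u !index_cat (negbTE yv) (negbTE xv) /= eqxx addn0 leq_addr.
by rewrite mem_rcons inE (negbTE yv) orbF => /eqP.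
Qed.

Lemma olast_rcons r x : olast (rcons r x) = Some x.
Proof. by rewrite /olast rev_rcons. Qed.

Lemma olast_index r a : uniq r -> a \in r ->
  exists2 x, olast r = Some x & index a r <= index x r.
Proof.
case/lastP: r => // r x; rewrite rcons_uniq => /andP[xr _] ar.
exists x; first exact: olast_rcons.
move: ar; rewrite -index_mem size_rcons ltnS => /leq_trans; apply.
by rewrite -cats1 index_cat (negbTE xr) leq_addr.
Qed.

Lemma olast_filter p r :
  (forall x, olast r = Some x -> p x) -> olast (filter p r) = olast r.
Proof.
case/lastP: r => // r x; rewrite olast_rcons => /(_ x erefl) px.
by rewrite filter_rcons px olast_rcons.
Qed.

End Sequences.

(** * Threads of an event and the edges that generate the orders *)

Section Traces.
Variables (Id Thread Loc Lock : eqType).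
Local Notation event := (event Id Thread Loc Lock).
Local Notation trace := (trace Id Thread Loc Lock).
Implicit Types (s r : seq event) (a b e : event) (t : Thread) (l : Lock).

(** The location is dropped: what matters is that a read or write has a single thread and touches no
    lock. *)
Definition is_access e : bool :=
  if event_op e is (Read _ | Write _) then true else false.

Lemma access_is_readwrite (x : Loc) e : is_read x e || is_write x e -> is_access e.
Proof. by rewrite /is_read /is_write /is_access => /orP[]/eqP ->. Qed.

Lemma access_threads e : is_access e -> threads_of_event e = [:: event_thread e].
Proof. by rewrite /is_access /threads_of_event; case: event_op. Qed.

Lemma access_event_of t e : is_access e -> event_of t e = (t == event_thread e).
Proof. by move=> ae; rewrite /event_of access_threads // inE. Qed.

Lemma access_not_lock l e : is_access e -> is_acq l e || is_rel l e = false.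
Proof. by rewrite /is_acq /is_rel /is_access; case: event_op. Qed.

Lemma event_of_thread e : event_of (event_thread e) e.
Proof. exact: mem_head. Qed.

Lemma same_threadP a b :
  reflect (exists2 t, event_of t a & event_of t b) (same_thread a b).
Proof. exact: hasP. Qed.

Lemma same_thread_sym a b : same_thread a b = same_thread b a.
Proof. by apply/same_threadP/same_threadP => -[t]; exists t. Qed.

Lemma access_same_thread a b :
  is_access a -> same_thread a b -> event_of (event_thread a) b.
Proof. by move=> aa /same_threadP[t]; rewrite access_event_of // => /eqP ->. Qed.

Lemma trace_uniq (s : trace) : uniq s.
Proof. exact: map_uniq (trace_ids_uniq s). Qed.

Lemma le_TO_HB s a b : le_TO s a b -> le_HB s a b.
Proof. by move=> ab R _; apply; left. Qed.

Lemma le_HB_SHB s a b : le_HB s a b -> le_SHB s a b.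
Proof. by move=> ab R _; apply; left. Qed.

Lemma same_thread_HB s a b : le_tr s a b -> same_thread a b -> le_HB s a b.
Proof. by move=> ab st; apply: le_TO_HB => R _; apply; rewrite ab. Qed.

Lemma last_write_SHB s a b : b \in s -> last_write s b = Some a -> le_SHB s a b.
Proof. by move=> bs ab R _; apply; right. Qed.

(** Unfolds both nested least orders, thread order inside HB, into one induction over generating
    edges. *)
Lemma le_HB_ind s (R : event -> event -> Prop) : partial_order_on s R ->
  (forall a b, le_tr s a b -> same_thread a b -> R a b) ->
  (forall l a b, is_rel l a -> is_acq l b -> le_tr s a b -> R a b) ->
  forall a b, le_HB s a b -> R a b.
Proof.
move=> poR RTO Rlock a b; apply=> // {}a {}b [|[l /and3P[]]]; last exact: Rlock.
by apply=> // {}a {}b /andP[]; apply: RTO.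
Qed.

(* The only edges of HB that end in a read or a write are thread-order edges. *)
Lemma le_HB_pred s a e : uniq s -> is_access e -> le_HB s a e ->
  a = e \/ exists2 p, pred_event s e = Some p & le_HB s a p.
Proof.
move=> us acc_e.
(* The claim about the fixed [e] becomes a relation on all pairs, which is a partial order, so that
   [le_HB_ind] applies. *)
pose R a b := le_HB s a b /\
  (b = e -> a = e \/ exists2 p, pred_event s e = Some p & le_HB s a p).
suff RHB : forall a b, le_HB s a b -> R a b by case/RHB=> _; apply.
have poHB := le_HB_po s.
apply: le_HB_ind.
- split=> [b c [/(po_dom poHB)] //|b bs|b c [bc _] [cb _]|b c d].
  + by split; [apply: po_refl poHB _ bs | left].
  + exact: po_anti poHB _ _ bc cb.
  + move=> [bc Rbc] [cd Rcd]; split=> [|de]; first exact: po_trans poHB _ _ _ bc cd.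
    have [ce|[p pp cp]] := Rcd de; first exact: Rbc.
    by right; exists p => //; apply: po_trans poHB _ _ _ bc cp.
- move=> b c bc st; split=> [|ce]; first exact: same_thread_HB.
  subst c; have [->|be] := eqVneq b e; [by left | right].
  set r := [seq e' <- before s e | same_thread e e'].
  have [bs es ibe] := and3P bc.
  have lt_be : index b s < index e s.
    rewrite ltn_neqAle ibe andbT; apply: contra be => /eqP/(index_inj b) ->//.
  have br : b \in r.
    by rewrite mem_filter same_thread_sym st -(in_take _ bs) in lt_be *.
  have ur : uniq r by rewrite filter_uniq // take_uniq.
  have [p lp ibp] := olast_index ur br.
  exists p => //; have := olast_mem lp; rewrite mem_filter => /andP[ep pb].
  have ps : p \in s := mem_take pb.
  apply: same_thread_HB.
    (* Filtering keeps the order, and positions in the initial segment [before s e] are positions in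
       [s]. *)
    rewrite /le_tr bs ps /=; move: ibp; rewrite leq_index_filter //; last first.
      by rewrite same_thread_sym.
    have bb : b \in before s e by rewrite /before in_take.
    by rewrite -{3 4}(cat_take_drop (index e s) s) !index_cat bb pb.
  (* An access has one thread, so [b] and [p], which each share a thread with [e], both belong to
     it. *)
  apply/same_threadP; exists (event_thread e).
    by apply: access_same_thread; rewrite // same_thread_sym.
  exact: access_same_thread.
- move=> l b c rb ac bc; split=> [|ce].
    by move=> Q _; apply; right; exists l; rewrite rb ac.
  by have := access_not_lock l acc_e; rewrite -ce ac.
Qed.

(** * Totality of HB on the events of a lock, and prefixes of projections *)

Lemma sorted_le_tr s : uniq s -> sorted (le_tr s) s.
Proof.
case: s => // x0 s us; apply/(sortedP x0) => i lt_i.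
by rewrite /le_tr !mem_nth ?(ltnW lt_i) // !index_uniq ?(ltnW lt_i) // leqnSn.
Qed.

(** The pairs of letters that may be adjacent in a word of critical sections of [l]. *)
Definition lock_step l : rel (Thread * operation Thread Loc Lock) :=
  fun x y => [&& x.2 == Acq _ _ l, y.2 == Rel _ _ l & x.1 == y.1] ||
             (x.2 == Rel _ _ l) && (y.2 == Acq _ _ l).

Lemma sorted_lock_step s l : lock_well_formed s l ->
  sorted (relpre (fun e => (event_thread e, event_op e)) (lock_step l))
    (on_lock s l).
Proof.
case=> ts /prefixP[w]; rewrite -sorted_map => def_w.
have : sorted (lock_step l)
    (flatten [seq [:: (t, Acq Thread Loc l); (t, Rel Thread Loc l)] | t <- ts]).
  case: ts {def_w} => //= t ts; rewrite {1}/lock_step /= !eqxx /=.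
  elim: ts t => //= t' ts IH t.
  by rewrite {1 2}/lock_step /= !eqxx; apply: IH.
by rewrite def_w => /cat_sorted2[].
Qed.

(** Consecutive events of [l] are HB-ordered: an acquire and its release by thread order, a release
    and the next acquire by a lock edge. Transitivity gives the rest. *)
Lemma lock_HB s l a b : uniq s -> lock_well_formed s l ->
  is_acq l a || is_rel l a -> is_acq l b || is_rel l b ->
  le_tr s a b -> le_HB s a b.
Proof.
move=> us wf la lb /and3P[as_ bs ab].
(* Equality is added because [sorted_leq_index] is given reflexivity on the whole type, while
   [le_HB s] is reflexive only on events of [s]. *)
pose leT x y := `[< x = y \/ le_HB s x y >].
have leT_refl : reflexive leT by move=> x; apply/asboolP; left.
have leT_tr : transitive leT.
  move=> y x z /asboolP[->//|xy] /asboolP[<-|yz]; apply/asboolP; right=> //.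
  exact: po_trans (le_HB_po s) _ _ _ xy yz.
have : sorted leT (on_lock s l).
  have tr_sorted : sorted (le_tr s) (on_lock s l).
    apply: sorted_filter (sorted_le_tr us) => y x z.
    exact: (po_trans (le_tr_po s)).
  have := conj (sorted_lock_step wf) tr_sorted; move/andP.
  rewrite -sorted_relI; apply: sub_sorted => x y /andP[/= /orP[/and3P|/andP]].
    move=> [_ _ /eqP/= st] xy; apply/asboolP; right; apply: same_thread_HB => //.
    apply/same_threadP; exists (event_thread x); last rewrite st;
      exact: event_of_thread.
  move=> [/= rx ay] xy; apply/asboolP; right=> Q _; apply; right; exists l.
  by apply/and3P.
move/(sorted_leq_index leT_tr leT_refl) => /(_ a b).
rewrite !mem_filter la lb as_ bs leq_index_filter // => /(_ isT isT ab).
by move/asboolP => [->|//]; apply: po_refl (le_HB_po s) _ bs.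
Qed.

(** Totality turns trace order within [P] into HB, which [r] respects, so [prefix_closed] applies.
    It serves for threads and for locks. *)
Lemma prefix_HB_total s r (P : pred event) : uniq s -> uniq r ->
  {subset r <= s} ->
  (forall a b, le_HB s a b -> b \in r -> a \in r /\ le_tr r a b) ->
  (forall a b, P a -> P b -> le_tr s a b -> le_HB s a b) ->
  prefix (filter P r) (filter P s).
Proof.
move=> us ur rs resp tot; apply: prefix_closed; rewrite ?filter_uniq //.
  by move=> a; rewrite !mem_filter => /andP[-> /rs].
move=> a b; rewrite !mem_filter => /andP[Pa as_] /andP[Pb br].
rewrite !leq_index_filter // Pa => ab.
have [||-> /and3P[]//] := resp a b => //.
by apply: tot; rewrite // /le_tr as_ rs.
Qed.

(** * Necessity: backward propagation along SHB edges *)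

Lemma SHB_not_below_pred (s s' : trace) e1 e2 (r : seq event) p :
  is_access e2 -> e2 \in trace_events s ->
  correct_reordering s s' -> respects_HB s s' ->
  ~~ event_of (event_thread e2) e1 ->
  trace_events s' = r ++ [:: e1; e2] \/ trace_events s' = r ++ [:: e2; e1] ->
  pred_event s e2 = Some p -> ~ le_SHB s e1 p.
Proof.
move=> acc2 e2s [_ reads] resp ne1 shape pred_p.
have us' := trace_uniq s'.
have e2s' : e2 \in trace_events s'.
  by case: shape => ->; rewrite mem_cat !inE eqxx ?orbT.
have HBs' a b : le_HB s a b -> b \in trace_events s' ->
    a \in trace_events s' /\ le_tr s' a b.
  by move=> ab; have [as_ bs] := po_dom (le_HB_po s) ab; apply: resp.
pose final a := (olast (on_thread s' (event_thread a)) == Some a).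
pose inv a := (a \in trace_events s') &&
  ((if event_op a is Read _ then true else false) ==> ~~ final a).
have not_final a b : le_tr s' a b -> event_of (event_thread a) b -> a <> b ->
    ~~ final a.
  move=> /and3P[as_ bs ab] tb ne; apply/negP => /eqP last_a.
  have [||c] := @olast_index _ (on_thread s' (event_thread a)) b.
  - by rewrite filter_uniq.
  - by rewrite mem_filter tb.
  rewrite last_a => -[<-]; rewrite leq_index_filter ?event_of_thread // => ba.
  by apply: ne; apply: (po_anti (le_tr_po s')); rewrite /le_tr as_ bs.
(* The conjunct [le_tr s a b] supplies antisymmetry, since the implication is vacuous when [inv]
   fails. *)
pose R a b := le_tr s a b /\ (inv b -> inv a /\ le_tr s' a b).
have poR : partial_order_on s R.
  split=> [a b [/(po_dom (le_tr_po s))] //|a as_|a b [ab _] [ba _]|a b c].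
  - split=> [|ia]; first exact: po_refl (le_tr_po s) _ as_.
    by split=> //; apply: po_refl (le_tr_po s') _ _; case/andP: ia.
  - exact: po_anti (le_tr_po s) _ _ ab ba.
  - move=> [ab Rab] [bc Rbc]; split; first exact: po_trans (le_tr_po s) _ _ _ ab bc.
    move=> /Rbc[/Rab[ia ab'] bc']; split=> //.
    exact: po_trans (le_tr_po s') _ _ _ ab' bc'.
have SHB_R a b : le_SHB s a b -> R a b.
  apply=> // {}a {}b [|[bs lw]].
    apply: le_HB_ind => // [{}a {}b ab st|l {}a {}b ra acb ab]; split=> //.
      move=> ib; have [||as' ab'] := HBs' a b; first exact: same_thread_HB.
        by case/andP: ib.
      split=> //; have [->//|/eqP ne] := eqVneq a b.
      (* A read has a single thread, so [b] is a later event of that thread in [s']. *)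
      rewrite /inv as' /=; apply/implyP => rd; apply: not_final ab' _ ne.
      by apply: access_same_thread st; move: rd; rewrite /is_access; case: event_op.
    move=> /andP[bs' _]; have [||as' ab'] := HBs' a b => //.
      by move=> Q _; apply; right; exists l; rewrite ra acb.
    by split=> //; rewrite /inv as' (eqP ra).
  split; first exact: last_write_tr.
  case/andP=> bs' /implyP ib.
  have [x rdb] : exists x, is_read x b.
    by move: lw; rewrite /last_write /is_read; case: event_op => // x _; exists x.
  (* By [inv], the read [b] is not last in its thread of [s'], so its last write is preserved. *)
  have lw' : last_write s' b = Some a.
    rewrite (reads b x) // => /eqP lb.
    by move: ib; rewrite /final lb (eqP rdb) => /(_ isT).
  have ab' := last_write_tr bs' lw'; split=> //.
  rewrite /inv; case/and3P: (ab') => -> _ _ /=.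
  move: lw; rewrite /last_write; case: event_op => // y /olast_mem.
  by rewrite mem_filter => /andP[/eqP -> _].
have := olast_mem pred_p; rewrite mem_filter => /andP[st pb].
have tp := access_same_thread acc2 st.
have ps : p \in trace_events s := mem_take pb.
have lt_p : index p s < index e2 s by move: pb; rewrite /before in_take.
have ne2 : p <> e2 by move=> pe; rewrite pe ltnn in lt_p.
have [||ps' pe2] := HBs' p e2 => //.
  apply: same_thread_HB; last by rewrite same_thread_sym.
  by rewrite /le_tr ps e2s ltnW.
have ip : inv p.
  rewrite /inv ps' /=; apply/implyP => rd; apply: not_final pe2 _ ne2.
  have acc_p : is_access p by move: rd; rewrite /is_access; case: event_op.
  by move: tp; rewrite !access_event_of // eq_sym.
have pe1 : p <> e1 by move=> pe; rewrite pe (negbTE ne1) in tp.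
case/SHB_R => _ /(_ ip)[_ /and3P[e1s' _]].
(* As [p] is neither [e1] nor [e2], it lies in [r], hence strictly before [e1], against the order
   just obtained. *)
have pr : p \in r.
  move: ps'; case: shape => ->; rewrite mem_cat !inE;
  by case/or3P => // /eqP // /esym.
have e1r : e1 \notin r.
  move: us'; case: shape => ->; rewrite cat_uniq /= !negb_or => /and3P[_ ];
  by case/and3P.
have : index p r < size r by rewrite index_mem.
by case: shape => ->; rewrite !index_cat pr (negbTE e1r) ltnNge => /negP h1 h2;
  apply: h1; apply: leq_trans (leq_addr _ _) h2.
Qed.

(** * Sufficiency: construction of the witness *)

Lemma SHB_closed_race (s : trace) e1 e2 :
  is_access e1 -> is_access e2 -> event_thread e1 != event_thread e2 ->
  le_tr s e1 e2 ->
  (forall p, pred_event s e2 = Some p -> ~ le_SHB s e1 p) ->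
  exists s' s'' : trace, [/\ correct_reordering s s', respects_HB s s' &
    trace_events s' = trace_events s'' ++ [:: e1; e2]].
Proof.
move=> acc1 acc2 ne12 /and3P[e1s e2s le12] not_below.
have us := trace_uniq s.
have poSHB := le_SHB_po s.
pose S a := `[< exists p, (pred_event s e1 = Some p \/ pred_event s e2 = Some p)
                          /\ le_SHB s a p >].
have S_closed a b : le_SHB s a b -> S b -> S a.
  move=> ab /asboolP[p [pp bp]]; apply/asboolP; exists p; split=> //.
  exact: po_trans poSHB _ _ _ ab bp.
have pred_lt e p : pred_event s e = Some p -> index p s < index e s.
  move/olast_mem; rewrite mem_filter => /andP[_ pb].
  by move: (pb); rewrite /before in_take // (mem_take pb).
have S_pred e a p : (e = e1 \/ e = e2) -> pred_event s e = Some p ->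
    le_HB s a p -> S a.
  move=> e12 pp ap; apply/asboolP; exists p; split; last exact: le_HB_SHB.
  by case: e12 => <-; [left | right].
(* Trace order keeps [e1] from lying below its own predecessor; the hypothesis excludes the
   predecessor of [e2]. *)
have nS1 : ~~ S e1.
  apply/asboolP => -[p [[pp|pp] ep]]; last exact: not_below pp ep.
  have /and3P[_ _] := le_SHB_tr ep.
  by rewrite leqNgt pred_lt.
have nS2 : ~~ S e2.
  apply/asboolP => -[p [[pp|pp] /le_SHB_tr/and3P[_ _]]].
    by rewrite leqNgt (leq_trans (pred_lt _ _ pp) le12).
  by rewrite leqNgt pred_lt.
have ne_e : e1 != e2 by apply: contra ne12 => /eqP ->.
pose r := filter S s; pose r' := r ++ [:: e1; e2].
have in_r a : (a \in r) = S a && (a \in trace_events s) by rewrite mem_filter.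
have e1r : e1 \notin r by rewrite in_r (negbTE nS1).
have e2r : e2 \notin r by rewrite in_r (negbTE nS2).
have ur' : uniq r'.
  rewrite cat_uniq filter_uniq //= !inE !negb_or ne_e.
  by rewrite (negbTE e1r) (negbTE e2r).
have r's : {subset r' <= trace_events s}.
  move=> a; rewrite mem_cat in_r !inE => /or3P[/andP[]//|/eqP->//|/eqP->//].
have resp a b : le_HB s a b -> b \in r' -> a \in r' /\ le_tr r' a b.
  move=> ab; have [as_ bs] := po_dom (le_HB_po s) ab => br'.
  suff [ar' iab] : a \in r' /\ index a r' <= index b r' by rewrite /le_tr ar' br'.
  (* Anything else HB-below [e] is HB-below its predecessor, hence in [S] and so in [r]. *)
  have low e : (e = e1 \/ e = e2) -> le_HB s a e ->
      a \in r' /\ index a r' <= index e r'.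
    move=> e12 /le_HB_pred[|||[p pp ap]] //.
    - by case: e12 => ->.
    - by move=> ->; split=> //; case: e12 => ->; rewrite mem_cat !inE eqxx ?orbT.
    have ar : a \in r by rewrite in_r as_ (S_pred _ _ _ e12 pp ap).
    have er : e \notin r by case: e12 => ->.
    rewrite !mem_cat ar; split=> //; rewrite !index_cat ar (negbTE er).
    by apply: leq_trans (leq_addr _ _); apply: ltnW; rewrite index_mem.
  move: br'; rewrite mem_cat !inE => /or3P[br|/eqP be|/eqP be].
  - have Sb : S b by move: br; rewrite in_r => /andP[].
    have Sa : S a := S_closed _ _ (le_HB_SHB ab) Sb.
    have ar : a \in r by rewrite in_r Sa.
    rewrite mem_cat ar !index_cat ar br leq_index_filter //.
    by case/and3P: (le_HB_tr ab).
  - by apply: low => //; left.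
  - by apply: low => //; right.
have locks l : lock_well_formed r' l.
  have [ts wf] := trace_locks s l; exists ts; apply: prefix_trans wf.
  have /prefixP[w ->] : prefix (on_lock r' l) (on_lock s l).
    apply: prefix_HB_total => // a b la lb.
    exact: lock_HB us (trace_locks s l) la lb.
  by rewrite map_cat prefix_prefix.
have locks_r l : lock_well_formed r l.
  have := locks l; rewrite /lock_well_formed /on_lock /r' filter_cat /=.
  by rewrite !access_not_lock // cats0.
(* Events of [r] may follow [e1] in [s], so [r'] is only a permutation of a subsequence of [s]. *)
have ids : uniq [seq event_id e | e <- r'].
  have /(perm_map (@event_id _ _ _ _))/perm_uniq <- : perm_eq (filter (mem r') s) r'.
    apply: uniq_perm; rewrite ?filter_uniq // => a.
    by rewrite mem_filter andb_idr //; apply: r's.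
  by apply: subseq_uniq (trace_ids_uniq s); apply/map_subseq/filter_subseq.
have ids_r : uniq [seq event_id e | e <- r].
  by move: ids; rewrite map_cat cat_uniq => /and3P[].
exists (Trace ids locks), (Trace ids_r locks_r); split=> //; last first.
  by move=> a b _ _; apply: resp.
split=> [t _|a x].
  apply: prefix_HB_total => // a b ta tb ab; apply: same_thread_HB => //.
  by apply/same_threadP; exists t.
rewrite /= mem_cat !inE => /or3P[ar|/eqP ->|/eqP ->] rd not_last.
- have Sa : S a by move: ar; rewrite in_r => /andP[].
  have as_ : a \in trace_events s by move: ar; rewrite in_r => /andP[].
  (* What precedes [a] in [r'] is what precedes it in [s], restricted to [S]. *)
  rewrite /last_write (eqP rd) /before /r' index_cat ar takel_cat ?index_size //.
  rewrite take_index_filter // -filter_predI.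
  rewrite (eq_filter (a2 := predI S (is_write x))); last by move=> b /=; rewrite andbC.
  (* The last write in [s] is SHB-below [a], hence in [S], and survives the restriction. *)
  rewrite filter_predI; apply: olast_filter => b lw; apply: S_closed Sa.
  by apply: last_write_SHB; rewrite // /last_write (eqP rd).
(* Having different threads, [e1] and [e2] are each last in their own thread of [r'], which exempts
   them from the last-write condition. *)
- case: not_last; rewrite /on_thread /r' filter_cat /= event_of_thread.
  by rewrite access_event_of // (negbTE ne12) cats1 olast_rcons.
- case: not_last; rewrite /on_thread /r' filter_cat /= event_of_thread.
  by rewrite access_event_of // eq_sym (negbTE ne12) cats1 olast_rcons.
Qed.

End Traces.

Theorem theorem3p3 (Id Thread Loc Lock : eqType)
    (s : trace Id Thread Loc Lock) (e1 e2 : event Id Thread Loc Lock) :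
  conflicting e1 e2 -> le_tr s e1 e2 ->
  HB_schedulable_race s e1 e2 <->
  pred_event s e2 = None \/
  exists2 p, pred_event s e2 = Some p & ~ le_SHB s e1 p.
Proof.
move=> conf le12; have [ne12 [x /and3P[rw1 rw2 _]]] := conf.
have acc1 := access_is_readwrite rw1; have acc2 := access_is_readwrite rw2.
have /and3P[_ e2s _] := le12.
split=> [[_ _ [s' [s'' [cr resp shape]]]]|below].
  case pp: (pred_event s e2) => [p|]; [right | by left].
  exists p => //; apply: (SHB_not_below_pred acc2 e2s cr resp _ shape pp).
  by rewrite access_event_of // eq_sym.
have [|s' [s'' [cr resp shape]]] := SHB_closed_race acc1 acc2 ne12 le12.
  by move=> p; case: below => [->|[q -> nq] [<-]].
by split=> //; exists s', s''; split=> //; left.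
Qed.
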